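(* Let $\eta_m=\mathcal{N}(x_m,\Gamma_m)$ be a Krylov posterior for the linear system $Ax_*=b$, and for some $d\ge 1$ (with $1\le m<g-d$) let $\widehat\eta_m=\mathcal{N}(x_m,\widehat\Gamma_m)$ be its rank-$d$ approximation. Then the $A$-Wasserstein distance between $\eta_m$ and $\widehat\eta_m$ is $$W_A(\eta_m,\widehat\eta_m)=\left(\sum_{i=m+d+1}^{g}\phi_i\right)^{1/2}.$$
   Context: Let $A\in\mathbb{R}^{n\times n}$ be symmetric positive definite, $b\in\mathbb{R}^n$, $Ax_*=b$, $x_0\in\mathbb{R}^n$ an initial guess, and $r_0=b-Ax_0$ (nonzero). Let $\mathcal{K}_i(A,r_0)=\operatorname{span}\{r_0,Ar_0,\ldots,A^{i-1}r_0\}$, and let $g\le n$ be the grade of $r_0$ with respect to $A$: the minimum value with $\mathcal{K}_g(A,r_0)=\mathcal{K}_{g+i}(A,r_0)$ for all $i\ge 1$. Krylov prior: let $V=[v_1\ \cdots\ v_g]\in\mathbb{R}^{n\times g}$ satisfy $V^TAV=I_g$ and $\operatorname{span}\{v_1,\ldots,v_i\}=\mathcal{K}_i(A,r_0)$ for $1\le i\le g$; let $\phi_i=(v_i^Tr_0)^2$ and $\Phi=\operatorname{diag}(\phi_1,\ldots,\phi_g)$. The Krylov prior is $\eta_0=\mathcal{N}(x_0,\Gamma_0)$ with $\Gamma_0=V\Phi V^T$. Write $V_{i:j}=[v_i\ \cdots\ v_j]$ and $\Phi_{i:j}=\operatorname{diag}(\phi_i,\ldots,\phi_j)$. Krylov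 posteriors (those produced by the solver BayesCG under the Krylov prior): $\eta_m=\mathcal{N}(x_m,\Gamma_m)$ with $x_m=x_0+V_{1:m}V_{1:m}^Tr_0$ and $\Gamma_m=V_{m+1:g}\Phi_{m+1:g}V_{m+1:g}^T$, $1\le m<g$. The rank-$d$ approximation of $\eta_m$ is $\widehat\eta_m=\mathcal{N}(x_m,\widehat\Gamma_m)$ with $\widehat\Gamma_m=V_{m+1:m+d}\Phi_{m+1:m+d}V_{m+1:m+d}^T$, where $d\ge 1$ and $1\le m<g-d$. $\mathcal{N}(x,\Sigma)$ is the Gaussian distribution with mean $x$ and (possibly singular) covariance $\Sigma$. With $\|x\|_A=\|A^{1/2}x\|_2$, the $A$-Wasserstein distance between $\mu$ and $\nu$ is $W_A(\mu,\nu)=\left(\inf_{\pi\in\Pi(\mu,\nu)}\int_{\mathbb{R}^n\times\mathbb{R}^n}\|M-N\|_A^2\,d\pi(M,N)\right)^{1/2}$, where $\Pi(\mu,\nu)$ is the set of probability distributions on $\mathbb{R}^n\times\mathbb{R}^n$ with marginals $\mu$ and $\nu$. *)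

(* Defs.v *)
From HB Require Import structures.
From mathcomp Require Import all_boot all_order all_algebra.
From mathcomp Require Import all_classical all_reals all_analysis.
From mathcomp Require Import measurable_realfun.

Set Implicit Arguments.
Unset Strict Implicit.
Unset Printing Implicit Defensive.

Import Order.TTheory GRing.Theory Num.Theory.
Import numFieldNormedType.Exports.

Local Open Scope classical_set_scope.
Local Open Scope ring_scope.

(* R^n carries the sigma-algebra generated by the n coordinate functions, as
   [n.-tuple T] does in the library; it is the Borel sigma-algebra. *)
Section measurable_colvec.
Context {R : realType} (n : nat).

Let coord (i : 'I_n) (x : 'cV[R]_n) : R := x i ord0.

Let colvec_set0 : g_sigma_preimage coord set0.
Proof. exact: sigma_algebra0. Qed.

Let colvec_setC B : g_sigma_preimage coord B -> g_sigma_preimage coord (~` B).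
Proof. exact: sigma_algebraC. Qed.

Let colvec_bigcup (F : (set 'cV[R]_n)^nat) :
  (forall i, g_sigma_preimage coord (F i)) ->
  g_sigma_preimage coord (\bigcup_i F i).
Proof. exact: sigma_algebra_bigcup. Qed.

HB.instance Definition _ := @isMeasurable.Build default_measure_display
  'cV[R]_n (g_sigma_preimage coord) colvec_set0 colvec_setC colvec_bigcup.

Lemma measurable_coord (i : 'I_n) :
  measurable_fun [set: 'cV[R]_n] (fun x => x i ord0).
Proof.
move=> _ Y mY; rewrite setTI; apply: sub_sigma_algebra => /=.
rewrite -bigcup_seq/=; exists i => /=; first by rewrite mem_index_enum.
by exists Y => //; rewrite setTI.
Qed.

Lemma measurable_fun_coordP d (T : measurableType d) (f : T -> 'cV[R]_n) :
  measurable_fun [set: T] f <->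
  forall i, measurable_fun [set: T] (fun t => f t i ord0).
Proof.
split=> [mf i|mf].
  exact: (measurableT_comp (measurable_coord i) mf).
suff : g_sigma_preimage (fun i t => f t i ord0) `<=` measurable.
  rewrite (g_sigma_preimage_comp coord f) => prefS.
  by move=> _ A mA; apply: prefS; exists A.
apply: smallest_sub; first exact: sigma_algebra_measurable.
rewrite -bigcup_seq => A [i _ [B mB <-]]; exact: mf.
Qed.

End measurable_colvec.

Definition affine (R : realType) (m n : nat) (x : 'cV[R]_m) (S : 'M[R]_(m, n))
    (z : 'cV[R]_n) : 'cV[R]_m := x + S *m z.

Lemma measurable_affine (R : realType) (m n : nat) (x : 'cV[R]_m)
    (S : 'M[R]_(m, n)) : measurable_fun [set: 'cV[R]_n] (affine x S).
Proof.
apply/measurable_fun_coordP => i; rewrite /affine.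
under eq_fun do rewrite !mxE.
apply: measurable_funD => //; apply: measurable_sum => j.
by apply: measurable_funM => //; exact: measurable_coord.
Qed.

HB.instance Definition _ (R : realType) (m n : nat) (x : 'cV[R]_m)
    (S : 'M[R]_(m, n)) :=
  isMeasurableFun.Build _ _ _ _ (affine x S) (measurable_affine x S).

(* The scalar is typed in [measurableTypeR R], where [normal_prob] lives. *)
Definition vcons (R : realType) (n : nat)
    (p : measurableTypeR R * 'cV[R]_n) : 'cV[R]_n.+1 :=
  col_mx p.1%:M p.2 : 'cV[R]_(1 + n).

Lemma measurable_vcons (R : realType) (n : nat) :
  measurable_fun [set: measurableTypeR R * 'cV[R]_n] (@vcons R n).
Proof.
apply/measurable_fun_coordP => i; rewrite /vcons.
under eq_fun do rewrite mxE.
case: (fintype.split (i : 'I_(1 + n))) => j.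
  by under eq_fun do rewrite mxE ord1 mulr1n; exact: measurable_fst.
exact: (measurableT_comp (measurable_coord j) measurable_snd).
Qed.

HB.instance Definition _ (R : realType) (n : nat) :=
  isMeasurableFun.Build _ _ _ _ (@vcons R n) (@measurable_vcons R n).

(* N(0, I_n): the law of n independent standard normal coordinates. *)
Fixpoint std_gaussian (R : realType) (n : nat) : probability 'cV[R]_n R :=
  match n with
  | 0 => \d_(0 : 'cV[R]_0)
  | n'.+1 => distribution
      (normal_prob (0 : R) 1 \x std_gaussian R n')%E (@vcons R n')
  end.

Section matrices.
Context {R : realType} (n : nat).

Definition posdef (A : 'M[R]_n) :=
  A^T = A /\ forall x : 'cV[R]_n, x != 0 -> 0 < (x^T *m A *m x) ord0 ord0.

Definition possemidef (A : 'M[R]_n) :=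
  A^T = A /\ forall x : 'cV[R]_n, 0 <= (x^T *m A *m x) ord0 ord0.

(* M^(1/2), the unique symmetric positive semidefinite square root of a
   symmetric positive semidefinite M (meaningless for other M). *)
Definition mxsqrt (M : 'M[R]_n) : 'M[R]_n :=
  get [set S : 'M[R]_n | possemidef S /\ S *m S = M].

Definition norm2 (x : 'cV[R]_n) : R := Num.sqrt (\sum_i x i ord0 ^+ 2).

Definition normA (A : 'M[R]_n) (x : 'cV[R]_n) : R := norm2 (mxsqrt A *m x).

(* N(x, Sigma) is the law of x + Sigma^(1/2) Z with Z ~ N(0, I_n), which also
   covers singular Sigma. *)
Definition gaussian (x : 'cV[R]_n) (Sigma : 'M[R]_n) : probability 'cV[R]_n R :=
  distribution (std_gaussian R n) (affine x (mxsqrt Sigma)).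

Definition couplings (mu nu : probability 'cV[R]_n R) :
    set (probability ('cV[R]_n * 'cV[R]_n)%type R) :=
  [set pi | (forall B, measurable B -> pi (B `*` setT) = mu B) /\
            (forall B, measurable B -> pi (setT `*` B) = nu B)].

Definition wassersteinA (A : 'M[R]_n) (mu nu : probability 'cV[R]_n R) :
    \bar R :=
  sqrte (ereal_inf
    [set (\int[pi]_z (normA A (z.1 - z.2) ^+ 2)%:E)%E | pi in couplings mu nu]).

Definition krylov (A : 'M[R]_n) (r : 'cV[R]_n) (i : nat) : {vspace 'cV[R]_n} :=
  <<[seq A ^+ j *m r | j <- iota 0 i]>>%VS.

Definition stationary_at (A : 'M[R]_n) (r : 'cV[R]_n) (g : nat) :=
  forall i, (1 <= i)%N -> krylov A r g = krylov A r (g + i).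

Definition is_grade (A : 'M[R]_n) (r : 'cV[R]_n) (g : nat) :=
  stationary_at A r g /\ forall k, stationary_at A r k -> (g <= k)%N.

(* Vectors v_1, ..., v_g are given by a family v : nat -> 'cV_n indexed from 1;
   its values outside 1..g are irrelevant. *)

(* V_{i:j} = [v_i ... v_j] *)
Definition vcols (v : nat -> 'cV[R]_n) (i j : nat) : 'M[R]_(n, j.+1 - i) :=
  \matrix_(k, l) v (i + l)%N k ord0.

Definition is_krylov_basis (A : 'M[R]_n) (r : 'cV[R]_n) (g : nat)
    (v : nat -> 'cV[R]_n) :=
  (vcols v 1 g)^T *m A *m vcols v 1 g = 1%:M /\
  forall i, (1 <= i <= g)%N ->
    <<[seq v j | j <- iota 1 i]>>%VS = krylov A r i.

Definition phi (v : nat -> 'cV[R]_n) (r : 'cV[R]_n) (i : nat) : R :=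
  ((v i)^T *m r) ord0 ord0 ^+ 2.

(* Phi_{i:j} = diag(phi_i, ..., phi_j) *)
Definition Phi (v : nat -> 'cV[R]_n) (r : 'cV[R]_n) (i j : nat) :
    'M[R]_(j.+1 - i) :=
  diag_mx (\row_l phi v r (i + l)%N).

(* The covariance of the Krylov prior is the case i = 1, j = g. *)
Definition krylov_cov (v : nat -> 'cV[R]_n) (r : 'cV[R]_n) (i j : nat) :
    'M[R]_n :=
  vcols v i j *m Phi v r i j *m (vcols v i j)^T.

Definition post_mean (v : nat -> 'cV[R]_n) (x0 r : 'cV[R]_n) (m : nat) :
    'cV[R]_n :=
  x0 + vcols v 1 m *m (vcols v 1 m)^T *m r.

Definition krylov_posterior (v : nat -> 'cV[R]_n) (x0 r : 'cV[R]_n)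
    (g m : nat) : probability 'cV[R]_n R :=
  gaussian (post_mean v x0 r m) (krylov_cov v r m.+1 g).

Definition approx_posterior (v : nat -> 'cV[R]_n) (x0 r : 'cV[R]_n)
    (d m : nat) : probability 'cV[R]_n R :=
  gaussian (post_mean v x0 r m) (krylov_cov v r m.+1 (m + d)).

End matrices.

(* Main.v *)
Require Import Defs.
From HB Require Import structures.
From mathcomp Require Import all_boot all_order all_algebra.
From mathcomp Require Import all_classical all_reals all_analysis.
From mathcomp Require Import measurable_realfun complex ring lra.

Set Implicit Arguments.
Unset Strict Implicit.
Unset Printing Implicit Defensive.

Import Order.TTheory GRing.Theory Num.Theory.
Import numFieldNormedType.Exports.

Local Open Scope classical_set_scope.
Local Open Scope ring_scope.

(** The posterior covariance is the sum of phi_i v_i v_i^T over m < i <= g, and its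
    rank-d approximation keeps the terms with i <= m + d. Both laws have the same
    mean x, and the v_i are orthonormal for the inner product of A. So the second
    law is the image of the first under the A-orthogonal projection x + P (M - x) on
    the affine space through x spanned by the v_i with m < i <= m + d, and this
    projection is the optimal transport.

    It is a coupling of cost sum of phi_i over m + d < i <= g
    ([projection_coupling_cost]). No coupling (M, N) is cheaper
    ([coupling_cost_ge]): by Bessel's inequality the squared A-norm of M - N is at
    least the sum over i > m + d of the squared A-inner products of v_i with M - N;
    in these N can be replaced by x, almost surely, and what remains is the sum of
    the variances phi_i of M in the directions v_i. Both bounds are proved for an
    arbitrary A-orthonormal family ([wassersteinA_projection]).

    Three facts support this argument. First, Gaussian laws are defined through
    symmetric square roots, which exist by the spectral theorem
    ([psd_sqrt_exists]). Second, x + B Z with Z standard Gaussian has a law that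
    depends on B B^T only ([std_gaussian_affine_law]); this is what identifies the
    law of x + P S Z, S being the root of the first covariance, with the second
    law. Matrices with equal B B^T differ by a product of reflections
    ([gram_eq_reflections]), and the standard Gaussian is invariant under
    reflections ([std_invariant_householder]), which reduces to the plane, where it
    follows from affine substitutions in iterated integrals
    ([normal2_reflection]). Third, the inner product of c and Z has second moment
    the squared length of c ([std_gaussian_second_moment]), again by turning c onto
    an axis, and by the value 1 of the variance of the standard normal law
    ([normal_second_moment]). *)

(** * Square roots of positive semidefinite matrices *)

Lemma poly_interpolation (F : fieldType) (f : F -> F) (s : seq F) :
  exists p : {poly F}, {in s, forall x, p.[x] = f x}.
Proof.
elim: s => [|a s [p pf]]; first by exists 0.
have [as_|as_] := boolP (a \in s).
  by exists p => x; rewrite inE => /predU1P[->|]; exact: pf.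
pose q := \prod_(b <- s) ('X - b%:P).
have qa : q.[a] != 0 by rewrite -rootE root_prod_XsubC.
exists (p + ((f a - p.[a]) / q.[a]) *: q) => x.
rewrite hornerD hornerZ inE => /predU1P[->|xs]; first by rewrite divfK// addrC subrK.
have /rootP-> : root q x by rewrite root_prod_XsubC.
by rewrite mulr0 addr0 pf.
Qed.

Lemma horner_mx_sym (R : comNzRingType) n (M : 'M[R]_n.+1) p :
  M^T = M -> (horner_mx M p)^T = horner_mx M p.
Proof.
move=> Msym; elim/poly_ind: p => [|p c IH]; first by rewrite rmorph0 trmx0.
rewrite rmorphD rmorphM /= horner_mx_X horner_mx_C linearD /= tr_scalar_mx.
rewrite -[_ * M]/(_ *m M) trmx_mul IH Msym; congr (_ + _).
by apply: comm_mx_horner; exact: comm_mx_refl.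
Qed.

Section psd.
Variables (R : rcfType).

(** The spectral theorem over the complexification of the real closed field: a
    real symmetric matrix is Hermitian there, and its eigenvalues are real. They
    are then roots of the real characteristic polynomial, hence eigenvalues of
    the real matrix. *)
Lemma sym_diagonalizable n (M : 'M[R]_n.+1) : M^T = M ->
  exists (P : 'M[R[i]]_n.+1) (d : 'I_n.+1 -> R), [/\ P \in unitmx,
    map_mx (real_complex R) M =
      invmx P *m diag_mx (\row_i (d i)%:C%C) *m P
    & forall i, eigenvalue M (d i)].
Proof.
move=> Msym; set MC := map_mx _ M.
have MCh : MC \is hermsymmx.
  apply: realsym_hermsym.
    apply/is_hermitianmxP; rewrite expr0 scale1r map_mx_id//.
    by rewrite /MC map_trmx Msym.
  by apply/mxOverP => i j; rewrite mxE complex_real.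
have [P [e [PU ME ereal]]] : exists P : 'M[R[i]]_n.+1, exists e : 'rV[R[i]]_n.+1,
    [/\ P \in unitmx, MC = invmx P *m diag_mx e *m P & e \is a mxOver Num.real].
  exists (spectralmx MC), (spectral_diag MC); split.
  - exact: spectral_unit.
  - exact/orthomx_spectralP/hermitian_normalmx.
  - exact: hermitian_spectral_diag_real.
pose d i := complex.Re (e 0 i).
have dE i : (d i)%:C%C = e 0 i by rewrite RRe_real// (mxOverP ereal).
exists P, d; split; first exact: PU.
  rewrite ME; congr (_ *m diag_mx _ *m _).
  by apply/rowP => i; rewrite mxE dE.
move=> i; rewrite eigenvalue_root_char -(fmorph_root (real_complex R)) map_char_poly.
rewrite -eigenvalue_root_char [X in eigenvalue _ X]dE; apply/eigenvalueP.
exists (row i P).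
  by rewrite -row_mul -/MC ME !mulmxA mulmxV// mul1mx row_mul row_diag_mx -scalemxAl -rowE.
apply/negP => /eqP r0.
have /row_freeP[Q] : row_free P by rewrite row_free_unit.
move=> /(congr1 (row i)); rewrite row_mul r0 mul0mx.
by move/rowP/(_ i)/eqP; rewrite !mxE eqxx eq_sym oner_eq0.
Qed.

Lemma psd_eigenvalue_ge0 n (M : 'M[R]_n) a :
  (forall x : 'cV[R]_n, 0 <= (x^T *m M *m x) 0 0) -> eigenvalue M a -> 0 <= a.
Proof.
move=> Mpos /eigenvalueP[u uM u0].
have := Mpos u^T; rewrite trmxK uM -scalemxAl mxE.
have u2 : 0 < (u *m u^T) 0 0.
  rewrite mxE lt_def sumr_ge0 ?andbT; last by move=> i _; rewrite mxE -expr2 sqr_ge0.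
  apply: contraNneq u0 => /eqP; rewrite psumr_eq0 => [/allP uu|i _]; last first.
    by rewrite mxE -expr2 sqr_ge0.
  apply/eqP/rowP => i; have := uu i (mem_index_enum _).
  by rewrite !mxE mulf_eq0 orbb => /eqP.
by rewrite pmulr_lge0.
Qed.

(** The root is sought among the polynomials in M, so that it is real and
    symmetric even though the diagonalization of M is complex: a polynomial p
    that takes the value l^(1/4) at every eigenvalue l satisfies p(M)^4 = M.
    A fourth root T, rather than a square root, is taken because T^2 = T T^T is
    then visibly positive semidefinite. *)
Lemma psd_sqrt_exists n (M : 'M[R]_n) :
  M^T = M -> (forall x : 'cV[R]_n, 0 <= (x^T *m M *m x) 0 0) ->
  exists S : 'M[R]_n, [/\ S^T = S,
    forall x : 'cV[R]_n, 0 <= (x^T *m S *m x) 0 0 & S *m S = M].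
Proof.
case: n M => [|n] M Msym Mpos.
  exists M; split => //; first by rewrite [LHS]flatmx0 [RHS]flatmx0.
have [P [d [PU ME eigd]]] := sym_diagonalizable Msym.
have [p pE] := poly_interpolation (fun x => Num.sqrt (Num.sqrt x)) (codom d).
pose T := horner_mx M p.
have Tsym : T^T = T by exact: horner_mx_sym.
exists (T *m T); split.
- by rewrite trmx_mul Tsym.
- move=> x; rewrite -{1}Tsym !mulmxA -trmx_mul -mulmxA mxE.
  by apply: sumr_ge0 => i _; rewrite mxE -expr2 sqr_ge0.
have -> : T *m T *m (T *m T) = horner_mx M (p ^+ 4).
  by rewrite rmorphXn /= -/T !exprS expr0 mulr1 -!mulmxE !mulmxA.
apply: (@map_mx_inj _ _ (real_complex R)).
rewrite map_horner_mx ME horner_mx_uconjC// horner_mx_diag.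
congr (_ *m diag_mx _ *m _).
apply/rowP => i; rewrite !mxE horner_map /= horner_exp pE ?codom_f//.
have d0 := psd_eigenvalue_ge0 Mpos (eigd i).
by rewrite (exprM _ 2 2) !sqr_sqrtr ?sqrtr_ge0.
Qed.
End psd.

(** * Householder reflections *)

Section dot.
Context {R : realFieldType}.

Definition dot n (u v : 'cV[R]_n) : R := (u^T *m v) 0 0.

Lemma dotE n (u v : 'cV[R]_n) : dot u v = \sum_i u i 0 * v i 0.
Proof. by rewrite /dot mxE; apply: eq_bigr => i _; rewrite mxE. Qed.

Lemma dotC n (u v : 'cV[R]_n) : dot u v = dot v u.
Proof. by rewrite !dotE; apply: eq_bigr => i _; rewrite mulrC. Qed.

Lemma dotDr n (u v w : 'cV[R]_n) : dot u (v + w) = dot u v + dot u w.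
Proof. by rewrite /dot mulmxDr mxE. Qed.

Lemma dotZr n a (u v : 'cV[R]_n) : dot u (a *: v) = a * dot u v.
Proof. by rewrite /dot -scalemxAr mxE. Qed.

Lemma dotNr n (u v : 'cV[R]_n) : dot u (- v) = - dot u v.
Proof. by rewrite /dot mulmxN mxE. Qed.

Lemma dotDl n (u v w : 'cV[R]_n) : dot (v + w) u = dot v u + dot w u.
Proof. by rewrite dotC dotDr !(dotC u). Qed.

Lemma dotNl n (u v : 'cV[R]_n) : dot (- v) u = - dot v u.
Proof. by rewrite dotC dotNr dotC. Qed.

Lemma dot_sumr n (w : 'cV[R]_n) (I : Type) (r : seq I) (F : I -> 'cV[R]_n) :
  dot w (\sum_(i <- r) F i) = \sum_(i <- r) dot w (F i).
Proof. by rewrite /dot mulmx_sumr summxE. Qed.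

Lemma dot_ge0 n (u : 'cV[R]_n) : 0 <= dot u u.
Proof. by rewrite dotE sumr_ge0// => i _; rewrite -expr2 sqr_ge0. Qed.

Lemma dot_eq0 n (u : 'cV[R]_n) : (dot u u == 0) = (u == 0).
Proof.
apply/eqP/eqP => [|->]; last by rewrite /dot mulmx0 mxE.
rewrite dotE => /eqP; rewrite psumr_eq0 => [/allP u0|i _]; last by rewrite -expr2 sqr_ge0.
apply/colP => i; have := u0 i (mem_index_enum _).
by rewrite !mxE mulf_eq0 orbb => /eqP.
Qed.

Lemma dot_col_mx m n (u1 v1 : 'cV[R]_m) (u2 v2 : 'cV[R]_n) :
  dot (col_mx u1 u2) (col_mx v1 v2) = dot u1 v1 + dot u2 v2.
Proof. by rewrite /dot tr_col_mx mul_row_col mxE. Qed.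

Lemma mul_col_dot m n (p : 'cV[R]_m) (u v : 'cV[R]_n) :
  p *m (u^T *m v) = dot u v *: p.
Proof. by rewrite [u^T *m v]mx11_scalar mul_mx_scalar. Qed.

(** For p = 0 this is the identity, since x / 0 = 0. *)
Definition householder n (p : 'cV[R]_n) : 'M[R]_n :=
  1%:M - (2 / dot p p) *: (p *m p^T).

Lemma householderE n (p x : 'cV[R]_n) :
  householder p *m x = x - (2 * dot p x / dot p p) *: p.
Proof.
rewrite mulmxBl mul1mx -scalemxAl -mulmxA mul_col_dot scalerA.
by rewrite mulrAC.
Qed.

Lemma householder_sym n (p : 'cV[R]_n) : (householder p)^T = householder p.
Proof. by rewrite linearB /= trmx1 linearZ /= trmx_mul trmxK. Qed.

Lemma householder_fix n (p x : 'cV[R]_n) : dot p x = 0 -> householder p *m x = x.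
Proof. by move=> px; rewrite householderE px mulr0 mul0r scale0r subr0. Qed.

Lemma householderK n (p : 'cV[R]_n) : householder p *m householder p = 1%:M.
Proof.
have [->|p0] := eqVneq p 0.
  by rewrite /householder mul0mx scaler0 subr0 mulmx1.
rewrite {1}/householder mulmxBl mul1mx -scalemxAl /householder.
have pp : p *m p^T *m (p *m p^T) = dot p p *: (p *m p^T).
  by rewrite mulmxA -(mulmxA p) mul_col_dot scalemxAl.
rewrite mulmxBr mulmx1 -scalemxAr pp scalerA divfK ?dot_eq0// scaler_nat.
by rewrite mulr2n opprD addrA subrr sub0r scalerN opprK subrK.
Qed.

(** Vectors of equal length are mirror images of each other in the hyperplane
    orthogonal to their difference. *)
Lemma householder_swap n (u w : 'cV[R]_n) : dot u u = dot w w ->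
  householder (u - w) *m u = w.
Proof.
move=> uw; have [/eqP|uw0] := eqVneq (u - w) 0.
  rewrite subr_eq0 => /eqP ->.
  by rewrite subrr householder_fix// /dot trmx0 mul0mx mxE.
rewrite householderE.
have -> : dot (u - w) (u - w) = 2 * dot (u - w) u.
  rewrite !(dotDl, dotNl, dotDr, dotNr) (dotC w u) uw.
  by move: (dot u w) (dot w w) => x y; ring.
have : 2 * dot (u - w) u != 0.
  have : dot (u - w) (u - w) != 0 by rewrite dot_eq0.
  apply: contra => /eqP; rewrite !(dotDl, dotNl, dotDr, dotNr) (dotC w u) -uw.
  by move: (dot u w) (dot u u) => x y e0; apply/eqP; lra.
by move: (2 * _) => d d0; rewrite divff// scale1r opprB addrC subrK.
Qed.

Lemma householder_conj n (Q : 'M[R]_n) (p : 'cV[R]_n) : Q^T *m Q = 1%:M ->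
  Q^T *m householder (Q *m p) *m Q = householder p.
Proof.
move=> QQ; rewrite /householder mulmxBr mulmx1 mulmxBl QQ; congr (_ - _).
have -> : dot (Q *m p) (Q *m p) = dot p p.
  by rewrite /dot trmx_mul mulmxA -[_ *m Q^T *m Q]mulmxA QQ mulmx1.
rewrite -scalemxAr -scalemxAl; congr (_ *: _).
by rewrite trmx_mul !mulmxA QQ mul1mx -(mulmxA _ Q^T) QQ mulmx1.
Qed.

(** A form of Witt's extension theorem: two families of vectors (the rows of B
    and C) with the same Gram matrix differ by a product of reflections. Once
    all rows but one agree, the difference p of the remaining two is orthogonal
    to the common rows, because their inner products with these agree, and the
    reflection along p exchanges the two rows and fixes the others. The predicate
    P stands for any property that holds of products of reflections; it avoids
    introducing such products as a notion of their own. *)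
Lemma gram_eq_reflections n (P : 'M[R]_n -> Prop) m (B C : 'M[R]_(m, n)) :
  P 1%:M ->
  (forall Q p, P Q -> P (Q *m householder p)) ->
  B *m B^T = C *m C^T ->
  exists2 Q : 'M[R]_n, P Q /\ Q *m Q^T = 1%:M & B = C *m Q.
Proof.
move=> P1 PH; elim: m B C => [|m IH] B C.
  by move=> _; exists 1%:M; rewrite ?trmx1 ?mulmx1//; apply/matrixP => -[].
move: B C; change m.+1 with (1 + m)%N => B C.
rewrite -[B]vsubmxK -[C]vsubmxK.
move: (usubmx B) (dsubmx B) (usubmx C) (dsubmx C) => b B' c C'.
rewrite !tr_col_mx !mul_col_row => /eq_block_mx[bb bB _ BB].
have [Q [PQ QQ] BQ] := IH _ _ BB.
pose c1 := c *m Q; pose p := (b - c1)^T.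
have c1B : c1 *m B'^T = b *m B'^T.
  by rewrite bB BQ trmx_mul /c1 mulmxA -[c *m Q *m _]mulmxA QQ mulmx1.
have Bp : B' *m p = 0.
  by rewrite -[LHS]trmxK trmx_mul trmxK mulmxBl c1B subrr trmx0.
(* p is orthogonal to the rows of B' and the reflection along p maps c1 to b. *)
exists (Q *m householder p).
  split; first exact: PH.
  by rewrite trmx_mul householder_sym mulmxA -(mulmxA Q) householderK mulmx1.
rewrite mulmxA mul_col_mx -BQ -/c1 mul_col_mx; congr col_mx; last first.
  by rewrite /householder mulmxBr mulmx1 -scalemxAr mulmxA Bp mul0mx scaler0 subr0.
apply: trmx_inj; rewrite trmx_mul householder_sym /p linearB /= -opprB.
rewrite [householder _](_ : _ = householder (c1^T - b^T)).
  rewrite householder_swap// /dot !trmxK bb /c1 trmx_mul mulmxA.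
  by rewrite -[c *m Q *m _]mulmxA QQ mulmx1.
rewrite /householder; congr (_ - _ *: _); last by rewrite linearN /= mulmxN mulNmx opprK.
by rewrite dotNl dotNr opprK.
Qed.

End dot.

(** * Substitution and densities for nonnegative integrals *)

Section affine1.
Context {R : realType}.
Notation mu := (@lebesgue_measure R).
Implicit Types (a b : R).

Let aff a b : measurableTypeR R -> measurableTypeR R := fun x => a * x + b.

Let measurable_aff a b : measurable_fun setT (aff a b).
Proof. by apply: measurable_funD => //; apply: measurable_funM. Qed.

(** Both sides are measures in A, so it is enough to compare them on the
    half-open intervals. *)
Lemma lebesgue_measure_affine a b (A : set (measurableTypeR R)) :
  a != 0 -> measurable A -> mu A = (`|a|%:E * mu (aff a b @^-1` A))%E.
Proof.
move=> a0 mA.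
pose pmu : {measure set (measurableTypeR R) -> \bar R} := pushforward mu (aff a b).
pose nu := mscale (NngNum (normr_ge0 a)) (pmu (measurable_aff a b)).
rewrite (lebesgue_measure_unique (mu := nu))// => _ [[x y] _ <-] /=.
rewrite /mscale /= /pushforward lebesgue_measure_itv /= lte_fin.
have [a_lt0|a_gt0|] := ltrgtP a 0; last by move/eqP; rewrite (negbTE a0).
- have -> : aff a b @^-1` `]x, y]%classic = `[(y - b) / a, (x - b) / a[%classic.
    apply/seteqP; split => z /=; rewrite !in_itv/= /aff;
    by rewrite ler_ndivrMr// ltr_ndivlMr// lerBrDr ltrBlDr ![z * a]mulrC andbC.
  rewrite lebesgue_measure_itv /= lte_fin ltr_ndivrMr// divfK// ltrD2r.
  case: ifPn => _; last by rewrite mule0.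
  rewrite -!EFinB -EFinM ltr0_norm// -mulrBl opprB addrA subrK.
  by rewrite mulrCA mulNr divff// mulrN1 opprB.
- have -> : aff a b @^-1` `]x, y]%classic = `](x - b) / a, (y - b) / a]%classic.
    apply/seteqP; split => z /=; rewrite !in_itv/= /aff;
    by rewrite ltr_pdivrMr// ler_pdivlMr// ltrBlDr lerBrDr [z * a]mulrC.
  rewrite lebesgue_measure_itv /= lte_fin ltr_pdivrMr// divfK// ltrD2r.
  case: ifPn => _; last by rewrite mule0.
  rewrite -!EFinB -EFinM gtr0_norm// -mulrBl opprB addrA subrK.
  by rewrite mulrCA divff// mulr1.
Qed.

Lemma ge0_integral_affine a b (f : measurableTypeR R -> \bar R) :
  a != 0 -> measurable_fun setT f -> (forall x, 0 <= f x)%E ->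
  (\int[mu]_x f x = `|a|%:E * \int[mu]_x f (a * x + b)%R)%E.
Proof.
move=> a0 mf f0.
pose pmu : {measure set (measurableTypeR R) -> \bar R} := pushforward mu (aff a b).
transitivity (\int[mscale (NngNum (normr_ge0 a)) (pmu (measurable_aff a b))]_x f x)%E.
  by apply: eq_measure_integral => /= A mA _; rewrite (lebesgue_measure_affine b a0).
rewrite ge0_integral_mscale//=; congr (_ * _)%E.
by rewrite ge0_integral_pushforward.
Qed.

Lemma ge0_integral_comp_affine a b (f : measurableTypeR R -> \bar R) :
  a != 0 -> measurable_fun setT f -> (forall x, 0 <= f x)%E ->
  (\int[mu]_x f (a * x + b)%R = `|a|^-1%:E * \int[mu]_x f x)%E.
Proof.
move=> a0 mf f0; rewrite (ge0_integral_affine b a0 mf f0) muleA -EFinM.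
by rewrite mulVf ?normr_eq0// mul1e.
Qed.

End affine1.


Section density.
Context d (T : measurableType d) (R : realType).
Variables (mu nu : {measure set T -> \bar R}) (p : T -> R).
Hypotheses (mp : measurable_fun setT p) (p0 : forall x, 0 <= p x).
Hypothesis nuE : forall A, measurable A -> (nu A = \int[mu]_(x in A) (p x)%:E)%E.
Import HBNNSimple.

(** Both sides are additive in the integrand, so the case of indicator functions,
    which is the hypothesis on nu, gives the case of simple functions, and
    monotone convergence the general one. *)
Let density_nnsfun (h : {nnsfun T >-> R}) :
  (\int[nu]_x (h x)%:E = \int[mu]_x ((h x)%:E * (p x)%:E))%E.
Proof.
under [LHS]eq_integral do rewrite fimfunE -fsumEFin//.
rewrite [LHS]ge0_integral_fsum//; last 2 first.
  - by move=> r; exact/measurable_EFinP/measurableT_comp.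
  - by move=> n x _; rewrite EFinM nnfun_muleindic_ge0.
under [RHS]eq_integral.
  move=> x xD; rewrite muleC fimfunE -fsumEFin// ge0_mule_fsumr; last first.
    by move=> r; rewrite EFinM nnfun_muleindic_ge0.
  over.
rewrite [RHS]ge0_integral_fsum//; last 2 first.
  - move=> r; apply: emeasurable_funM; first exact/measurable_EFinP.
    by apply/measurable_EFinP; exact: measurableT_comp.
  - by move=> n x _; apply: mule_ge0; [rewrite lee_fin|rewrite EFinM nnfun_muleindic_ge0].
apply: eq_fsbigr => r _; rewrite integralZl_indic_nnsfun//= integral_indic// setIT.
have [r0|r0] := ltP r 0.
  rewrite preimage_nnfun0// measure0 mule0 integral0_eq// => x _.
  by rewrite indic0 mulr0 mule0.
rewrite nuE// -ge0_integralZl_EFin//; last 2 first.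
  - by move=> x _; rewrite lee_fin.
  - exact/measurable_funTS/measurable_EFinP.
rewrite integral_mkcond; apply: eq_integral => x _.
rewrite patchE indicE; case: ifPn => _; first by rewrite mulr1 muleC.
by rewrite mulr0 mule0.
Qed.

Lemma ge0_integral_density (f : T -> \bar R) :
  measurable_fun setT f -> (forall x, 0 <= f x)%E ->
  (\int[nu]_x f x = \int[mu]_x (f x * (p x)%:E))%E.
Proof.
move=> mf f0; pose f_ := nnsfun_approx measurableT mf.
transitivity (limn (fun n => \int[nu]_x (f_ n x)%:E))%E.
  rewrite -monotone_convergence//=.
  - by apply: eq_integral => x _; apply/esym/cvg_lim => //=; exact: cvg_nnsfun_approx.
  - by move=> n; exact/measurable_EFinP.
  - by move=> n x _; rewrite lee_fin.
  - by move=> x _ m n mn; rewrite lee_fin; exact/lefP/nd_nnsfun_approx.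
transitivity (limn (fun n => \int[mu]_x ((f_ n x)%:E * (p x)%:E)))%E.
  by congr (limn _); apply/funext => n; exact: density_nnsfun.
rewrite -monotone_convergence//=.
- apply: eq_integral => x _; apply/cvg_lim => //=.
  by apply: cvgeZr => //; exact: cvg_nnsfun_approx.
- by move=> n; apply: emeasurable_funM; exact/measurable_EFinP.
- by move=> n x _; rewrite mule_ge0// lee_fin.
- move=> x _ m n mn; rewrite lee_wpmul2r// lee_fin//.
  exact/lefP/nd_nnsfun_approx.
Qed.

End density.

(** * Rotational symmetry of the planar Gaussian *)

Section plane.
Context {R : realType}.
Notation mu := (@lebesgue_measure R).
Notation RR := (measurableTypeR R).

(** The matrix with rows (c, s) and (s, -c) is a general reflection of the
    plane. Iterated integration reduces its effect to affine substitutions in one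
    variable: replacing x by u = c x + s y turns the second coordinate into
    (s u - y) / c, and replacing then y by this value produces the factors 1 / |c|
    and |c|. *)
Lemma lebesgue2_reflection (c s : R) (G : RR * RR -> \bar R) :
  c ^+ 2 + s ^+ 2 = 1 -> measurable_fun setT G -> (forall z, 0 <= G z)%E ->
  (\int[mu]_x \int[mu]_y G (c * x + s * y, s * x - c * y)%R =
   \int[mu]_x \int[mu]_y G (x, y))%E.
Proof.
move=> cs mG G0.
have mGp (f g : RR * RR -> RR) : measurable_fun setT f -> measurable_fun setT g ->
    measurable_fun setT (fun z : RR * RR => G (f z, g z)).
  by move=> mf mg; apply: measurableT_comp => //; exact: measurable_fun_pair.
have mGs (f g : RR -> RR) : measurable_fun setT f -> measurable_fun setT g ->
    measurable_fun setT (fun z => G (f z, g z)).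
  by move=> mf mg; apply: measurableT_comp => //; exact: measurable_fun_pair.
(* For c = 0 the reflection exchanges the two variables up to sign. *)
have [c0|c0] := eqVneq c 0.
  have s0 : s != 0.
    apply/eqP => s0; move: cs; rewrite c0 s0 expr0n /= addr0 => /esym/eqP.
    by rewrite oner_eq0.
  have s1 : `|s|^-1%:E = 1%E :> \bar R.
    congr EFin; apply/eqP; rewrite invr_eq1 -sqrp_eq1// real_normK ?num_real//.
    by rewrite -cs c0 expr0n add0r.
  under eq_integral.
    move=> x _; rewrite (_ : integral _ _ _ = \int[mu]_y G (y, s * x)%R)%E; last first.
      rewrite -[RHS]mul1e -s1 -(@ge0_integral_comp_affine _ _ 0)//.
        by apply: eq_integral => y _; rewrite c0 !mul0r subr0 add0r addr0.
      exact: mGs.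
    over.
  rewrite (fubini_tonelli (fun z : RR * RR => G (z.2, s * z.1)%R))//=; last first.
    by apply: mGp => //; apply: measurable_funM.
  apply: eq_integral => x _.
  rewrite -[RHS]mul1e -s1 -(@ge0_integral_comp_affine _ _ 0 (fun y : RR => G (x, y)))//.
    by apply: eq_integral => y _; rewrite addr0.
  exact: mGs.
have mlin (a b : R) : measurable_fun setT (fun z : RR * RR => a * z.1 + b * z.2 : RR).
  by apply: measurable_funD; apply: measurable_funM.
rewrite (fubini_tonelli (fun z : RR * RR =>
  G (c * z.1 + s * z.2, s * z.1 - c * z.2)%R))//=; last first.
  apply: mGp; first exact: mlin.
  by under eq_fun do rewrite -mulNr; exact: mlin.
under eq_integral.
  move=> y _.
  rewrite (_ : integral _ _ _ =
    `|c|^-1%:E * \int[mu]_u G (u, (- c^-1) * y + s / c * u)%R)%E; last first.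
    rewrite -(@ge0_integral_comp_affine _ _ (s * y)
      (fun u : RR => G (u, (- c^-1) * y + s / c * u)%R))//; last first.
      by apply: mGs => //; apply: measurable_funD => //; apply: measurable_funM.
    apply: eq_integral => x _; congr (G (_, _)).
    transitivity ((c * s * x - c ^+ 2 * y) / c); first by field.
    by rewrite -(addrK (s ^+ 2) (c ^+ 2)) cs; field.
  over.
rewrite ge0_integralZl_EFin//; last 2 first.
- by move=> y _; apply: integral_ge0.
- apply: (measurable_fun_fubini_tonelli_F (fun z : RR * RR =>
    G (z.2, - c^-1 * z.1 + s / c * z.2)%R)) => //.
  by apply: mGp => //; exact: mlin.
rewrite (fubini_tonelli (fun z : RR * RR => G (z.2, - c^-1 * z.1 + s / c * z.2)%R))//=; last first.
  by apply: mGp => //; exact: mlin.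
rewrite -ge0_integralZl_EFin//; last 2 first.
- by move=> y _; apply: integral_ge0.
- apply: (measurable_fun_fubini_tonelli_G (fun z : RR * RR =>
    G (z.2, - c^-1 * z.1 + s / c * z.2)%R)) => //.
  by apply: mGp => //; exact: mlin.
apply: eq_integral => x _.
rewrite (@ge0_integral_comp_affine _ _ (s / c * x) (fun v : RR => G (x, v)))//; last 2 first.
- by rewrite oppr_eq0 invr_eq0.
- exact: mGs.
by rewrite muleA -EFinM normrN normfV invrK mulVf ?normr_eq0// mul1e.
Qed.

Notation N := (@normal_prob R 0 1).
Notation p := (@normal_pdf R 0 1).

Lemma normal_pdf01E x : p x = normal_peak 1 * expR (- x ^+ 2 / 2).
Proof.
by rewrite normal_pdfE ?oner_neq0//= /normal_fun subr0 expr1n.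
Qed.

Lemma ge0_integral_normal (f : RR -> \bar R) :
  measurable_fun setT f -> (forall x, 0 <= f x)%E ->
  (\int[N]_x f x = \int[mu]_x (f x * (p x)%:E))%E.
Proof.
move=> mf f0; apply: ge0_integral_density => //.
- exact: measurable_normal_pdf.
- exact: normal_pdf_ge0.
Qed.

Lemma ge0_integral_normal2 (G : RR * RR -> \bar R) :
  measurable_fun setT G -> (forall z, 0 <= G z)%E ->
  (\int[N]_x \int[N]_y G (x, y) =
   \int[mu]_x \int[mu]_y (G (x, y) * (p x * p y)%:E))%E.
Proof.
move=> mG G0.
have mp : measurable_fun setT p := measurable_normal_pdf 0 1.
have p0 : forall x, 0 <= p x := normal_pdf_ge0 0 1.
have mGs x : measurable_fun setT (fun y : RR => G (x, y)).
  by apply: measurableT_comp => //; exact: measurable_fun_pair.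
rewrite ge0_integral_normal; last 2 first.
- exact: (measurable_fun_fubini_tonelli_F G).
- by move=> x; apply: integral_ge0.
apply: eq_integral => x _.
rewrite ge0_integral_normal// -ge0_integralZr//; last 3 first.
- by apply: emeasurable_funM => //; exact/measurable_EFinP.
- by move=> y _; rewrite mule_ge0// lee_fin.
- by rewrite lee_fin.
by apply: eq_integral => y _; rewrite -muleA -EFinM mulrC.
Qed.

(** The density of the product of two standard normal laws is a function of
    x^2 + y^2, which the reflection preserves, as it does Lebesgue measure. *)
Lemma normal2_reflection (c s : R) (G : RR * RR -> \bar R) :
  c ^+ 2 + s ^+ 2 = 1 -> measurable_fun setT G -> (forall z, 0 <= G z)%E ->
  (\int[N]_x \int[N]_y G (c * x + s * y, s * x - c * y)%R =
   \int[N]_x \int[N]_y G (x, y))%E.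
Proof.
move=> cs mG G0.
have mp : measurable_fun setT p := measurable_normal_pdf 0 1.
have p0 : forall x, 0 <= p x := normal_pdf_ge0 0 1.
have mlin (a b : R) : measurable_fun setT (fun z : RR * RR => a * z.1 + b * z.2 : RR).
  by apply: measurable_funD; apply: measurable_funM.
pose T (z : RR * RR) : RR * RR := (c * z.1 + s * z.2, s * z.1 - c * z.2).
have mT : measurable_fun setT T.
  apply: measurable_fun_pair; first exact: mlin.
  by under eq_fun do rewrite -mulNr; exact: mlin.
have mGT : measurable_fun setT (G \o T) by exact: measurableT_comp.
pose q (z : RR * RR) : \bar R := (p z.1 * p z.2)%:E.
have mGq : measurable_fun setT (G \* q)%E.
  apply: emeasurable_funM => //; apply/measurable_EFinP.
  by apply: measurable_funM; exact: measurableT_comp.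
have Gq0 z : (0 <= (G \* q) z)%E by rewrite mule_ge0// lee_fin mulr_ge0.
transitivity (\int[mu]_x \int[mu]_y (G (T (x, y)) * q (x, y)))%E.
  exact: (ge0_integral_normal2 mGT (fun z => G0 (T z))).
transitivity (\int[mu]_x \int[mu]_y (G \* q) (x, y))%E; last first.
  exact/esym/ge0_integral_normal2.
rewrite -(lebesgue2_reflection cs mGq Gq0).
have qT x y : q (T (x, y)) = q (x, y).
  rewrite /q /T /= !normal_pdf01E; congr EFin.
  rewrite mulrACA [RHS]mulrACA -!expRD; congr (_ * expR _).
  transitivity (- ((c ^+ 2 + s ^+ 2) * (x ^+ 2 + y ^+ 2)) / 2); first by field.
  by rewrite cs; field.
under eq_integral do under eq_integral do rewrite -qT.
by [].
Qed.

End plane.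

(** * The variance of the standard normal law *)

Section second_moment.
Context {R : realType}.
Notation mu := (@lebesgue_measure R).
Notation p := (@normal_pdf R 0 1).

Let g (x : R) : R := expR (- x ^+ 2 / 2).

Let g_derive (x : R) : is_derive x (1 : R) g (- (x * g x)).
Proof.
have h : is_derive x (1 : R) ((- 2^-1) \*: (@id R ^+ 2)) (- 2^-1 *: ((2%:R * x ^+ 1) *: (1 : R))).
  exact: is_deriveZ.
have := is_derive1_comp (is_derive_expR _) h.
have -> : expR \o ((- 2^-1) \*: (@id R ^+ 2)) = g.
  by apply/funext => y; rewrite /g /= !fctE; congr expR; rewrite scaleNr mulNr mulrC.
move=> H; apply: is_derive_eq H _.
have -> : (- 2^-1 \*: @id R ^+ 2) x = - x ^+ 2 / 2.
  by rewrite !fctE /= scaleNr mulNr mulrC.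
rewrite -/(g x) expr1 /GRing.scale /=; by field.
Qed.

Let F (x : R) : R := x * g x.

(** F' = (1 - x^2) g compares the second moment of g with its total mass. As it
    changes sign at 1, it is integrated separately on [0, 1] and on [1, +oo[; F is 0
    at both ends of the half-line, so that the two integrals cancel. *)
Let F_derive (x : R) : is_derive x (1 : R) F ((1 - x ^+ 2) * g x).
Proof.
have := is_deriveM (is_derive_id x (1 : R)) (g_derive x).
rewrite (_ : id * g = F)// => H; apply: is_derive_eq H _.
rewrite /GRing.scale /=; ring.
Qed.

Let g_cont : continuous g.
Proof.
move=> x; apply: differentiable_continuous; apply/derivable1_diffP.
by have [] := g_derive x.
Qed.

Let F_cont : continuous F.
Proof.
move=> x; apply: differentiable_continuous; apply/derivable1_diffP.
by have [] := F_derive x.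
Qed.

Let k_cont : continuous (fun x : R => (1 - x ^+ 2) * g x).
Proof.
move=> x; apply: cvgM; last exact: g_cont.
by apply: (@cvgB _ R^o); [exact: cvg_cst|exact: exprn_continuous].
Qed.

Let k'_cont : continuous (fun x : R => (x ^+ 2 - 1) * g x).
Proof.
move=> x; apply: cvgM; last exact: g_cont.
by apply: (@cvgB _ R^o); [exact: exprn_continuous|exact: cvg_cst].
Qed.

(** From exp t >= 1 + t, with t = x^2 / 2, one gets F x <= 2 / x. *)
Let F_cvg : F x @[x --> +oo] --> (0 : R).
Proof.
apply/cvgr0Pnorm_le => e e0; near=> x.
have x0 : 0 < x by near: x; exact: nbhs_pinfty_gt.
rewrite ger0_norm; last by rewrite mulr_ge0 ?expR_ge0// ltW.
rewrite /F /g mulNr expRN ler_pdivrMr ?expR_gt0//.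
apply: (@le_trans _ _ (e * (1 + x ^+ 2 / 2))); last first.
  apply: ler_wpM2l; [exact: ltW|exact: expR_ge1Dx].
have : 2 / e <= x by near: x; apply: nbhs_pinfty_ge; exact: num_real.
rewrite ler_pdivrMr// => ex.
have := ler_wpM2l (ltW x0) ex.
nra.
Unshelve. all: by end_near. Qed.

Let g_ge0 x : 0 <= g x. Proof. exact: expR_ge0. Qed.

Let integral01 : (\int[mu]_(x in `[0%R, 1%R]) ((1 - x ^+ 2) * g x)%:E = (g 1)%:E)%E.
Proof.
rewrite (@continuous_FTC2 _ _ F)//.
- by rewrite /F mul1r mul0r sube0.
- exact: continuous_subspaceT.
- split => [x _||]; first by have [] := F_derive x.
  + exact/cvg_at_right_filter/F_cont.
  + exact/cvg_at_left_filter/F_cont.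
- by move=> x _; rewrite derive1E; apply: derive_val.
Qed.

Let integral1y : (\int[mu]_(x in `[1%R, +oo[) ((x ^+ 2 - 1) * g x)%:E = (g 1)%:E)%E.
Proof.
have D (x : R) : is_derive x (1 : R) (- F) (- ((1 - x ^+ 2) * g x)) by exact: is_deriveN.
have C : continuous (- F) by move=> x; apply: (@cvgN _ R^o); exact: F_cont.
rewrite (@ge0_continuous_FTC2y _ _ (- F) _ 0)//.
- by rewrite !fctE /F mul1r sub0e -EFinN opprK.
- by move=> x x1; rewrite mulr_ge0// subr_ge0 exprn_ege1.
- exact: continuous_subspaceT.
- by rewrite -oppr0; apply: cvgN; exact: F_cvg.
- exact/cvg_at_right_filter/C.
- move=> x _; rewrite derive1E (_ : _ * _ = - ((1 - x ^+ 2) * g x)); last by ring.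
  by apply: derive_val.
Qed.

Let integral0y (f : R -> R) : measurable_fun setT f -> (forall x, 0 <= f x) ->
  (\int[mu]_(x in `[0%R, +oo[) (f x)%:E =
   \int[mu]_(x in `[0%R, 1%R]) (f x)%:E + \int[mu]_(x in `[1%R, +oo[) (f x)%:E)%E.
Proof.
move=> mf f0.
rewrite -(@integral_itv_obnd_cbnd _ 1)//; last exact/measurable_funTS/measurable_EFinP.
rewrite -ge0_integral_setU//.
- by rewrite -itv_bndbnd_setU// bnd_simp.
- exact/measurable_funTS/measurable_EFinP.
- by move=> x _; rewrite lee_fin.
- rewrite disj_set2E; apply/eqP/seteqP; split => // x [] /=; rewrite !in_itv/= andbT.
  by move=> /andP[_ x1]; rewrite ltNge x1.
Qed.

Let mg : measurable_fun setT g. Proof. exact: continuous_measurable_fun. Qed.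
Let mx2g : measurable_fun setT (fun x : R => x ^+ 2 * g x).
Proof. by apply: measurable_funM. Qed.

Let integral0y_x2 : (\int[mu]_(x in `[0%R, +oo[) (x ^+ 2 * g x)%:E =
   \int[mu]_(x in `[0%R, +oo[) (g x)%:E)%E.
Proof.
rewrite !integral0y//; last by move=> x; rewrite mulr_ge0// sqr_ge0.
have -> : (\int[mu]_(x in `[0%R, 1%R]) (g x)%:E =
    \int[mu]_(x in `[0%R, 1%R]) (x ^+ 2 * g x)%:E + (g 1)%:E)%E.
  rewrite -integral01 -ge0_integralD//.
  - by apply: eq_integral => x _; rewrite -EFinD; congr EFin; ring.
  - by move=> x _; rewrite lee_fin mulr_ge0// sqr_ge0.
  - exact/measurable_funTS/measurable_EFinP.
  - move=> x /=; rewrite in_itv/= => /andP[x0 x1].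
    by rewrite lee_fin mulr_ge0// subr_ge0 expr_le1.
  - by apply/measurable_funTS/measurable_EFinP; exact: continuous_measurable_fun.
have -> : (\int[mu]_(x in `[1%R, +oo[) (x ^+ 2 * g x)%:E =
    \int[mu]_(x in `[1%R, +oo[) (g x)%:E + (g 1)%:E)%E.
  rewrite -integral1y -ge0_integralD//.
  - by apply: eq_integral => x _; rewrite -EFinD; congr EFin; ring.
  - by move=> x _; rewrite lee_fin.
  - exact/measurable_funTS/measurable_EFinP.
  - move=> x /=; rewrite in_itv/= andbT => x1.
    by rewrite lee_fin mulr_ge0// subr_ge0 exprn_ege1.
  - by apply/measurable_funTS/measurable_EFinP; exact: continuous_measurable_fun.
by rewrite addeA [RHS]addeAC.
Qed.

Lemma normal_second_moment :
  (\int[@normal_prob R 0 1]_x (x ^+ 2)%:E = 1)%E.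
Proof.
rewrite ge0_integral_normal//; last 2 first.
- by apply/measurable_EFinP.
- by move=> x; rewrite lee_fin sqr_ge0.
rewrite -(@integral_normal_pdf R 0 1).
have gE x : p x = normal_peak 1 * g x by exact: normal_pdf01E.
transitivity (\int[mu]_x ((normal_peak 1)%:E * (x ^+ 2 * g x)%:E))%E.
  by apply: eq_integral => x _; rewrite -!EFinM gE mulrCA.
transitivity (\int[mu]_x ((normal_peak 1)%:E * (g x)%:E))%E; last first.
  by apply: eq_integral => x _; rewrite -!EFinM gE.
rewrite !ge0_integralZl_EFin ?normal_peak_ge0//; last 4 first.
- by move=> x _; rewrite lee_fin.
- exact/measurable_EFinP.
- by move=> x _; rewrite lee_fin mulr_ge0// sqr_ge0.
- exact/measurable_EFinP.
congr (_ * _)%E.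
rewrite !ge0_symfun_integralT//.
- by congr (_ * _)%E; rewrite -set_itvcy integral0y_x2.
- by move=> x /=; rewrite /g sqrrN.
- by move=> x; rewrite mulr_ge0// sqr_ge0.
- by move=> x; apply: cvgM; [exact: exprn_continuous|exact: g_cont].
- by move=> x /=; rewrite /g sqrrN.
Qed.

End second_moment.

(** * Reflection invariance of the standard Gaussian *)

Section std_gaussian_invariance.
Context {R : realType}.
Notation RR := (measurableTypeR R).
Notation N := (@normal_prob R 0 1).
Notation G := (std_gaussian R).

Lemma measurable_mulmx m n (M : 'M[R]_(m, n)) :
  measurable_fun setT (fun x : 'cV[R]_n => M *m x).
Proof.
apply/measurable_fun_coordP => i; under eq_fun do rewrite mxE.
by apply: measurable_sum => j; apply: measurable_funM => //; exact: measurable_coord.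
Qed.

Definition std_invariant n (M : 'M[R]_n) := forall B : set 'cV[R]_n,
  measurable B -> G n ((fun x => M *m x) @^-1` B) = G n B.

Lemma std_invariant1 n : std_invariant (1%:M : 'M[R]_n).
Proof.
move=> B _; congr (G n _); apply/seteqP; split=> x /=; by rewrite mul1mx.
Qed.

Lemma std_invariantM n (M K : 'M[R]_n) :
  std_invariant M -> std_invariant K -> std_invariant (M *m K).
Proof.
move=> HM HK B mB.
have mMB : measurable ((fun x => M *m x) @^-1` B).
  by rewrite -[X in measurable X]setTI; exact: measurable_mulmx.
rewrite -(HM B mB) -(HK _ mMB); congr (G n _).
by apply/seteqP; split=> x /=; rewrite mulmxA.
Qed.

Lemma vcons_surj n (z : 'cV[R]_n.+1) : exists x y, z = vcons (x, y).
Proof.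
exists (z 0 0), (@dsubmx _ 1 n 1 z); rewrite /vcons -[LHS](@vsubmxK _ 1 n 1) /=.
have -> // : @usubmx _ 1 n 1 z = (z 0 0)%:M.
by apply/matrixP => i j; rewrite !ord1 !mxE eqxx mulr1n; congr (z _ _); apply/val_inj.
Qed.

Lemma std_gaussianS n B :
  G n.+1 B = (\int[N]_x G n [set y | B (vcons (x, y))])%E.
Proof.
rewrite [LHS]/= /distribution /pushforward /product_measure1.
apply: eq_integral => x _ /=; congr (G n _).
by apply/seteqP; split=> y /=; rewrite /xsection /= inE.
Qed.

Lemma measurable_section n (B : set 'cV[R]_n.+1) : measurable B ->
  measurable_fun setT (fun x : RR => G n [set y | B (vcons (x, y))]).
Proof.
move=> mB.
have -> : (fun x : RR => G n [set y | B (vcons (x, y))]) =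
    G n \o xsection (@vcons R n @^-1` B).
  apply/funext => x /=; congr (G n _).
  by apply/seteqP; split=> y /=; rewrite /xsection /= inE.
apply: measurable_fun_xsection.
by rewrite -[X in measurable X]setTI; exact: measurable_vcons.
Qed.

(** Evenness of the standard normal law is the planar symmetry under
    (x, y) |-> (-x, y), applied to a function of x. *)
Lemma normal_opp (f : RR -> \bar R) : measurable_fun setT f -> (forall x, 0 <= f x)%E ->
  (\int[N]_x f (- x)%R = \int[N]_x f x)%E.
Proof.
move=> mf f0.
have := @normal2_reflection R (-1) 0 (f \o fst).
rewrite sqrrN expr1n expr0n addr0 => /(_ erefl).
have mff : measurable_fun [set: RR * RR] (f \o fst) by exact: measurableT_comp.
move=> /(_ mff (fun z => f0 z.1)) H.
transitivity (\int[N]_x \int[N]_y (f \o fst) (-1 * x + 0 * y, 0 * x - -1 * y)%R)%E.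
  apply: eq_integral => x _.
  rewrite -[LHS]mule1 -(@probability_setT _ _ _ N) -integral_cst//.
  by apply: eq_integral => y _ /=; rewrite mulN1r mul0r addr0.
rewrite H; apply: eq_integral => x _.
rewrite -[RHS]mule1 -(@probability_setT _ _ _ N) -integral_cst//.
Qed.

Lemma std_invariant_lift n (K : 'M[R]_n) (M : 'M[R]_n.+1) : std_invariant K ->
  (forall x y, M *m vcons (x, y) = vcons (x, K *m y)) -> std_invariant M.
Proof.
move=> HK ME B mB; rewrite !std_gaussianS; apply: eq_integral => x _.
rewrite -[RHS]HK.
  by congr (G n _); apply/seteqP; split=> y /=; rewrite ME.
rewrite -[X in measurable X]setTI.
have mv : measurable_fun setT (fun y : 'cV[R]_n => vcons ((x : RR), y)).
  apply: (measurableT_comp (@measurable_vcons R n)).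
  by apply: measurable_fun_pair.
exact: mv.
Qed.

Lemma dot_vcons n (x x' : R) (y y' : 'cV[R]_n) :
  dot (vcons (x, y)) (vcons (x', y')) = x * x' + dot y y'.
Proof.
rewrite /vcons [LHS](@dot_col_mx _ 1 n); congr (_ + _).
by rewrite dotE big_ord1 !mxE !eqxx !mulr1n.
Qed.

Lemma vcons_linear n (a x x' : R) (y y' : 'cV[R]_n) :
  vcons (x, y) + a *: vcons (x', y') = vcons (x + a * x', y + a *: y').
Proof.
rewrite /vcons (@scale_col_mx _ 1 n 1) [LHS](@add_col_mx _ 1 n 1).
apply: (congr2 (@col_mx R 1 n 1)) => //=.
by apply/matrixP => i j; rewrite !ord1 !mxE eqxx !mulr1n.
Qed.

Lemma householder_vcons n (p0 x : R) (p y : 'cV[R]_n)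
  (k := 2 * (p0 * x + dot p y) / (p0 ^+ 2 + dot p p)) :
  householder (vcons (p0, p)) *m vcons (x, y) =
  vcons (x - k * p0, y - k *: p).
Proof.
by rewrite householderE -scaleNr vcons_linear !dot_vcons -expr2 -/k mulNr scaleNr.
Qed.

Lemma std_invariant_flip n (a : R) : std_invariant (householder (vcons (a, 0 : 'cV[R]_n))).
Proof.
have [->|a0] := eqVneq a 0.
  rewrite (_ : householder _ = 1%:M); first exact: std_invariant1.
  rewrite (_ : vcons _ = 0); first by rewrite /householder mul0mx scaler0 subr0.
  rewrite /vcons -[RHS](@col_mx0 _ 1 n 1); apply: (congr2 (@col_mx R 1 n 1)) => //=.
  by apply/matrixP => i j; rewrite !mxE mul0rn.
move=> B mB; rewrite !std_gaussianS.
rewrite -(normal_opp (measurable_section mB)); last by move=> x; exact: measure_ge0.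
apply: eq_integral => x _.
have E y : householder (vcons (a, 0)) *m vcons (x, y) = vcons (- x, y).
  rewrite householder_vcons /dot trmx0 !mul0mx [X in 2 * (_ + X)]mxE.
  by rewrite [X in _ / (_ + X)]mxE !addr0 scaler0 subr0; congr (vcons (_, _)); field.
by congr (G n _); apply/seteqP; split=> y /=; rewrite E.
Qed.

Lemma measurable_section2 n (B : set 'cV[R]_n.+2) : measurable B ->
  measurable_fun setT (fun x : RR * RR => G n [set z | B (vcons (x.1, vcons (x.2, z)))]).
Proof.
move=> mB; pose v (x : (RR * RR) * 'cV[R]_n) := vcons (x.1.1, vcons (x.1.2, x.2)).
have mv : measurable_fun setT v.
  apply: (measurableT_comp (@measurable_vcons R n.+1)).
  apply: measurable_fun_pair; first by apply: measurableT_comp.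
  apply: (measurableT_comp (@measurable_vcons R n)).
  by apply: measurable_fun_pair => //; apply: measurableT_comp.
have -> : (fun x : RR * RR => G n [set z | B (vcons (x.1, vcons (x.2, z)))]) =
    G n \o xsection (v @^-1` B).
  apply/funext => x /=; congr (G n _).
  by apply/seteqP; split=> y /=; rewrite /xsection /= inE.
by apply: measurable_fun_xsection; rewrite -[X in measurable X]setTI; exact: mv.
Qed.

(** The reflection acts on the first two coordinates by a planar reflection and
    fixes the others, so the planar result applies after integrating these out. *)
Lemma std_invariant_plane n (a b : R) :
  std_invariant (householder (vcons (a, vcons (b, 0 : 'cV[R]_n)))).
Proof.
have [->|b0] := eqVneq b 0.
  rewrite (_ : vcons (0, 0) = 0); first exact: std_invariant_flip.
  rewrite /vcons -[RHS](@col_mx0 _ 1 n 1); apply: (congr2 (@col_mx R 1 n 1)) => //=.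
  by apply/matrixP => i j; rewrite !mxE mul0rn.
move=> B mB; set D := a ^+ 2 + b ^+ 2.
have D0 : D != 0 by rewrite paddr_eq0 ?sqr_ge0// negb_and !sqrf_eq0 b0 orbT.
(* -c and -s are the cosine and sine of twice the polar angle of (a, b). *)
pose c := (b ^+ 2 - a ^+ 2) / D; pose s := - (2 * a * b) / D.
have cs : c ^+ 2 + s ^+ 2 = 1 by rewrite /c /s /D; field.
rewrite !std_gaussianS.
under eq_integral do rewrite std_gaussianS.
under [in RHS]eq_integral do rewrite std_gaussianS.
pose h (x : RR * RR) := G n [set z | B (vcons (x.1, vcons (x.2, z)))].
transitivity (\int[N]_x \int[N]_y h (x, y))%E; last by [].
rewrite -(normal2_reflection cs (measurable_section2 mB)); last first.
  by move=> x; exact: measure_ge0.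
apply: eq_integral => x _; apply: eq_integral => y _.
have E z : householder (vcons (a, vcons (b, 0))) *m vcons (x, vcons (y, z)) =
    vcons (c * x + s * y, vcons (s * x - c * y, z)).
  rewrite householder_vcons !dot_vcons /dot trmx0 !mul0mx mxE !addr0 -expr2 -/D.
  rewrite -(scaleNr _ (vcons _)) vcons_linear scaler0 addr0.
  by congr (vcons (_, vcons (_, _))); rewrite /c /s /D; field.
by congr (G n _); apply/seteqP; split=> z /=; rewrite E.
Qed.

(** A reflection along (p0, p) is conjugate to the one along (p0, w), for any w as
    long as p, by the reflection that exchanges p and w and leaves the first
    coordinate alone. *)
Lemma householder_lift n (p0 : R) (p w : 'cV[R]_n) : dot p p = dot w w ->
  exists2 M : 'M[R]_n.+1,
    (forall x y, M *m vcons (x, y) = vcons (x, householder (p - w) *m y)) &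
    householder (vcons (p0, p)) = M *m householder (vcons (p0, w)) *m M.
Proof.
move=> pw; pose M := householder (vcons (0, p - w)).
have ME x y : M *m vcons (x, y) = vcons (x, householder (p - w) *m y).
  by rewrite householder_vcons householderE expr0n mul0r !add0r mulr0 subr0.
exists M => //.
have MM : M^T *m M = 1%:M by rewrite householder_sym householderK.
rewrite -(householder_conj (vcons (p0, p)) MM) householder_sym -/M ME.
by rewrite householder_swap.
Qed.

Lemma norm_vcons n (u : 'cV[R]_n.+1) :
  dot u u = dot (vcons (Num.sqrt (dot u u), 0 : 'cV[R]_n)) (vcons (Num.sqrt (dot u u), 0)).
Proof.
by rewrite dot_vcons /dot trmx0 mul0mx [X in _ + X]mxE addr0 -expr2 sqr_sqrtr// dot_ge0.
Qed.

(** By induction on the dimension: the tail of p is turned onto the first axis of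
    its space by a reflection, which preserves the law of the tail by induction.
    This leaves a reflection in the plane of the first two coordinates. *)
Lemma std_invariant_householder n (p : 'cV[R]_n) : std_invariant (householder p).
Proof.
elim: n p => [|n IH] p.
  move=> B _; congr (G 0 _); apply/seteqP; split=> x /=;
  by rewrite [householder p *m x]flatmx0 [x]flatmx0.
have [p0 [p' ->]] := vcons_surj p.
case: n p' {p} IH => [|n] p' IH.
  by rewrite [p']flatmx0; exact: std_invariant_flip.
have [M ME ->] := householder_lift p0 (norm_vcons p').
have HM : std_invariant M by apply: std_invariant_lift ME; exact: IH.
exact: (std_invariantM (std_invariantM HM (std_invariant_plane _ _)) HM).
Qed.

End std_gaussian_invariance.

(** * Gaussian laws and their second moments *)

Section gaussian_laws.
Context {R : realType}.
Notation G := (std_gaussian R).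

(** A centered Gaussian law is determined by its covariance: two factors of the
    same covariance differ by a product of reflections, which preserves the
    standard Gaussian. *)
Lemma std_gaussian_affine_law m n (x : 'cV[R]_m) (B C : 'M[R]_(m, n)) S :
  B *m B^T = C *m C^T -> measurable S ->
  G n (affine x B @^-1` S) = G n (affine x C @^-1` S).
Proof.
move=> BC mS.
have [Q [invQ _] ->] := gram_eq_reflections (@std_invariant1 R n)
  (fun Q p HQ => std_invariantM HQ (std_invariant_householder p)) BC.
have mCS : measurable (affine x C @^-1` S).
  by rewrite -[X in measurable X]setTI; exact: measurable_affine.
rewrite -(invQ _ mCS); congr (G n _).
by apply/seteqP; split=> z /=; rewrite /affine mulmxA.
Qed.

Lemma ge0_integral_std_invariant n (M : 'M[R]_n) (f : 'cV[R]_n -> \bar R) :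
  std_invariant M -> measurable_fun setT f -> (forall z, 0 <= f z)%E ->
  (\int[G n]_z f (M *m z) = \int[G n]_z f z)%E.
Proof.
move=> invM mf f0.
have mM := measurable_mulmx M.
rewrite -(@ge0_integral_pushforward _ _ _ _ R _ mM (G n) setT f)//.
by apply: eq_measure_integral => B mB _; exact: invM.
Qed.

Lemma measurable_dot d (T : measurableType d) n (c : 'cV[R]_n) (h : T -> 'cV[R]_n) :
  measurable_fun setT h -> measurable_fun setT (fun t => dot c (h t)).
Proof.
move=> /measurable_fun_coordP mh; under eq_fun do rewrite dotE.
by apply: measurable_sum => i; apply: measurable_funM => //; exact: mh.
Qed.

Lemma measurable_dot_sqr d (T : measurableType d) n (c : 'cV[R]_n) (h : T -> 'cV[R]_n) :
  measurable_fun setT h -> measurable_fun setT (fun t => (dot c (h t) ^+ 2)%:E).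
Proof.
move=> mh; apply/measurable_EFinP; apply: measurable_funX; exact: measurable_dot.
Qed.

(** A reflection that turns c onto the first axis reduces the integral to the
    variance of one coordinate. *)
Lemma std_gaussian_second_moment n (c : 'cV[R]_n) :
  (\int[G n]_z (dot c z ^+ 2)%:E = (dot c c)%:E)%E.
Proof.
case: n c => [|n] c.
  rewrite dotE big_ord0 integral0_eq// => z _.
  by rewrite dotE big_ord0 expr0n.
set s := Num.sqrt (dot c c); pose e := vcons (s, 0 : 'cV[R]_n).
pose H := householder (c - e).
have He : H *m c = e by apply: householder_swap; exact: norm_vcons.
have cE z : dot c z = dot e (H *m z).
  by rewrite /dot -He trmx_mul /H householder_sym -mulmxA [_ *m (_ *m z)]mulmxA householderK mul1mx.
under eq_integral do rewrite cE.
have me : measurable_fun setT (fun z : 'cV[R]_n.+1 => (dot e z ^+ 2)%:E).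
  by apply: measurable_dot_sqr; exact: measurable_id.
rewrite (ge0_integral_std_invariant (std_invariant_householder _) me); last first.
  by move=> z; rewrite lee_fin sqr_ge0.
rewrite /= ge0_integral_distribution//; last by move=> z; rewrite lee_fin sqr_ge0.
rewrite fubini_tonelli1//=; last 2 first.
- by apply: measurableT_comp => //; exact: measurable_vcons.
- by move=> z; rewrite lee_fin sqr_ge0.
transitivity (\int[@normal_prob R 0 1]_x ((dot c c)%:E * (x ^+ 2)%:E))%E.
  apply: eq_integral => x _; rewrite /fubini_F.
  rewrite -[RHS]mule1 -(@probability_setT _ _ _ (G n)) -integral_cst//.
  apply: eq_integral => y _; rewrite /= /e.
  rewrite dot_vcons /dot trmx0 mul0mx [X in _ + X]mxE addr0 exprMn.
  by rewrite sqr_sqrtr ?dot_ge0.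
rewrite ge0_integralZl_EFin ?dot_ge0//; last 2 first.
- by move=> x _; rewrite lee_fin sqr_ge0.
- by apply/measurable_EFinP.
by rewrite normal_second_moment mule1.
Qed.

End gaussian_laws.

Section mxsqrt_theory.
Context {R : realType}.
Notation G := (std_gaussian R).

Lemma mxsqrtP n (M : 'M[R]_n) : possemidef M ->
  (mxsqrt M)^T = mxsqrt M /\ mxsqrt M *m mxsqrt M = M.
Proof.
move=> [Msym Mpos]; have [S [Ssym Spos SS]] := psd_sqrt_exists Msym Mpos.
have [] : possemidef (mxsqrt M) /\ mxsqrt M *m mxsqrt M = M; last by case.
by apply: (@getPex _ [set S : 'M[R]_n | possemidef S /\ S *m S = M]); exists S.
Qed.

Lemma normA_sqr n (A : 'M[R]_n) (w : 'cV[R]_n) :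
  normA A w ^+ 2 = dot (mxsqrt A *m w) (mxsqrt A *m w).
Proof.
rewrite /normA /norm2 sqr_sqrtr; first by rewrite dotE; apply: eq_bigr => i _.
by rewrite sumr_ge0// => i _; rewrite sqr_ge0.
Qed.

Lemma normA_sqrE n (A : 'M[R]_n) (w : 'cV[R]_n) : possemidef A ->
  normA A w ^+ 2 = dot w (A *m w).
Proof.
move=> /mxsqrtP[Ssym SS]; rewrite normA_sqr /dot trmx_mul Ssym.
by rewrite -mulmxA (mulmxA _ _ w) SS.
Qed.

(** In this form the squared norm is visibly measurable, and its Gaussian integral
    is a sum of second moments. *)
Lemma normA_sqr_rows n (A : 'M[R]_n) (w : 'cV[R]_n) :
  normA A w ^+ 2 = \sum_k dot (row k (mxsqrt A))^T w ^+ 2.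
Proof.
rewrite normA_sqr dotE; apply: eq_bigr => k _.
by rewrite -expr2 /dot trmxK -row_mul [in RHS]mxE.
Qed.

Lemma measurable_normA_sqr d (T : measurableType d) n (A : 'M[R]_n) (h : T -> 'cV[R]_n) :
  measurable_fun setT h -> measurable_fun setT (fun t => (normA A (h t) ^+ 2)%:E).
Proof.
move=> mh; apply/measurable_EFinP; under eq_fun do rewrite normA_sqr_rows.
by apply: measurable_sum => k; apply: measurable_funX; exact: measurable_dot.
Qed.

Lemma std_gaussian_normA_moment n (A L : 'M[R]_n) : possemidef A ->
  (\int[G n]_z (normA A (L *m z) ^+ 2)%:E = (\tr (A *m (L *m L^T)))%:E)%E.
Proof.
move=> /mxsqrtP[Ssym SS]; set S := mxsqrt A in Ssym SS *.
under eq_integral do rewrite normA_sqr_rows -sumEFin.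
rewrite ge0_integral_sum//; last 2 first.
- by move=> k; apply: measurable_dot_sqr; exact: measurable_mulmx.
- by move=> k z _; rewrite lee_fin sqr_ge0.
transitivity (\sum_k (dot (row k (S *m L))^T (row k (S *m L))^T)%:E)%E.
  apply: eq_bigr => k _; rewrite -std_gaussian_second_moment.
  by apply: eq_integral => z _; rewrite /dot !trmxK row_mul -mulmxA.
rewrite sumEFin; congr EFin.
have -> : \tr (A *m (L *m L^T)) = \tr ((S *m L) *m (S *m L)^T).
  by rewrite trmx_mul Ssym -SS -mulmxA mxtrace_mulC !mulmxA.
apply: eq_bigr => k _; rewrite /dot trmxK !mxE.
by apply: eq_bigr => j _; rewrite !mxE.
Qed.

End mxsqrt_theory.

(** * Sums of rank-one matrices and A-orthonormal families *)

Section rank1sum.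
Context {R : realType} (n : nat).

Definition rank1sum (u : nat -> 'cV[R]_n) (f : nat -> R) (a c : nat) : 'M[R]_n :=
  \sum_(a <= i < c) f i *: (u i *m (u i)^T).

Lemma rank1sum_sym u f a c : (rank1sum u f a c)^T = rank1sum u f a c.
Proof.
by rewrite /rank1sum linear_sum; apply: eq_bigr => i _; rewrite linearZ /= trmx_mul trmxK.
Qed.

Lemma rank1sum_mulmx u f a c (w : 'cV[R]_n) :
  rank1sum u f a c *m w = \sum_(a <= i < c) (f i * dot (u i) w) *: u i.
Proof.
rewrite /rank1sum mulmx_suml; apply: eq_bigr => i _.
by rewrite -scalemxAl -mulmxA mul_col_dot scalerA.
Qed.

Lemma rank1sum_quad u f a c (w : 'cV[R]_n) :
  dot w (rank1sum u f a c *m w) = \sum_(a <= i < c) f i * dot (u i) w ^+ 2.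
Proof.
rewrite rank1sum_mulmx dot_sumr; apply: eq_bigr => i _.
by rewrite dotZr (dotC w) expr2 mulrA.
Qed.

Lemma rank1sum_psd u f a c : (forall i, 0 <= f i) -> possemidef (rank1sum u f a c).
Proof.
move=> f0; split; first exact: rank1sum_sym.
move=> w; rewrite -mulmxA -/(dot _ _) rank1sum_quad.
by apply: sumr_ge0 => i _; rewrite mulr_ge0// sqr_ge0.
Qed.

Lemma rank1sum_conj u f a c (M : 'M[R]_n) :
  M *m rank1sum u f a c *m M^T = rank1sum (fun i => M *m u i) f a c.
Proof.
rewrite /rank1sum mulmx_sumr mulmx_suml; apply: eq_bigr => i _.
by rewrite -scalemxAr -scalemxAl trmx_mul !mulmxA.
Qed.

Lemma mxtrace_rank1sum u f a c (A : 'M[R]_n) :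
  \tr (A *m rank1sum u f a c) = \sum_(a <= i < c) f i * dot (u i) (A *m u i).
Proof.
rewrite /rank1sum mulmx_sumr linear_sum; apply: eq_bigr => i _ /=.
rewrite -scalemxAr mxtraceZ mulmxA mxtrace_mulC; congr (_ * _).
by rewrite /mxtrace big_ord1.
Qed.

Definition A_orthonormal (A : 'M[R]_n) (u : nat -> 'cV[R]_n) a c :=
  forall i j, (a <= i < c)%N -> (a <= j < c)%N -> dot (u i) (A *m u j) = (i == j)%:R.

Lemma big_nat_delta a c (V : lmodType R) (F : nat -> V) j : (a <= j < c)%N ->
  \sum_(a <= i < c) (i == j)%:R *: F i = F j.
Proof.
move=> jac; rewrite (big_rem j) ?mem_index_iota//= eqxx scale1r big1_seq ?addr0//.
move=> i /andP[_]; rewrite mem_rem_uniq ?iota_uniq// inE => /andP[/negbTE-> _].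
by rewrite scale0r.
Qed.

(** Bessel's inequality for the bilinear form of A: the left-hand side is the
    squared norm of the A-orthogonal projection y of w on the span of the u i, and
    w - y has nonnegative squared norm. *)
Lemma A_bessel A u a c (w : 'cV[R]_n) : possemidef A -> A_orthonormal A u a c ->
  \sum_(a <= i < c) dot (A *m u i) w ^+ 2 <= dot w (A *m w).
Proof.
move=> [Asym Apos] Au.
have ADot x y : dot (A *m x) y = dot x (A *m y).
  by rewrite /dot trmx_mul Asym mulmxA.
pose k i := dot (A *m u i) w; pose y := \sum_(a <= i < c) k i *: u i.
have wAy : dot w (A *m y) = \sum_(a <= i < c) k i ^+ 2.
  rewrite -ADot dot_sumr; apply: eq_bigr => i _.
  by rewrite dotZr ADot dotC expr2.
have yAy : dot y (A *m y) = \sum_(a <= i < c) k i ^+ 2.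
  rewrite -ADot {2}/y dot_sumr; apply: eq_big_nat => i iac.
  rewrite dotZr dotC -ADot expr2; congr (_ * _); rewrite {1}/y dot_sumr.
  rewrite -[RHS](@big_nat_delta a c R^o k i iac); apply: eq_big_nat => j jac.
  by rewrite dotZr ADot Au// [RHS]mulrC eq_sym.
have := Apos (w - y); rewrite -mulmxA -/(dot (w - y) (A *m (w - y))).
rewrite mulmxBr !(dotDl, dotNl, dotDr, dotNr) -(ADot y w) (dotC _ w) wAy yAy.
by rewrite opprB addrA subrK subr_ge0.
Qed.

(** The matrix on the left is the A-orthogonal projection on the span of the u i
    with a <= i < b. *)
Lemma A_proj_basis A u a b c j : (a <= b <= c)%N -> A_orthonormal A u a c ->
  (a <= j < c)%N ->
  rank1sum u (fun=> 1) a b *m A *m u j = if (j < b)%N then u j else 0.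
Proof.
move=> /andP[ab bc] Au jac; rewrite -mulmxA rank1sum_mulmx.
have dE i : (a <= i < b)%N -> (1 * dot (u i) (A *m u j)) *: u i = (i == j)%:R *: u i.
  by move=> /andP[ai ib]; rewrite mul1r Au ?ai ?(leq_trans ib).
rewrite (eq_big_nat _ _ dE); case: ifPn => jb.
  by rewrite big_nat_delta//; case/andP: jac => ->.
rewrite big_nat big1// => i /andP[_ ib]; case: eqP => [ij|]; last by rewrite scale0r.
by move: jb; rewrite -ij ib.
Qed.

End rank1sum.

(** * Couplings and the distance to a projected Gaussian *)

Section couplings.
Context {R : realType} (n : nat).
Notation G := (std_gaussian R n).

Definition affine2 (x : 'cV[R]_n) (S T : 'M[R]_n) (z : 'cV[R]_n) :
  'cV[R]_n * 'cV[R]_n := (affine x S z, affine x T z).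

Lemma measurable_affine2 x S T : measurable_fun setT (affine2 x S T).
Proof. by apply: measurable_fun_pair; exact: measurable_affine. Qed.

HB.instance Definition _ x S T :=
  isMeasurableFun.Build _ _ _ _ (affine2 x S T) (measurable_affine2 x S T).

(** Driving both components by the same Gaussian vector gives a coupling as soon as
    T is any factor of the second covariance, not only its symmetric root; this is
    the freedom that allows an optimal coupling. *)
Lemma affine2_coupling x (Sigma Sigma' T : 'M[R]_n) :
  possemidef Sigma' -> T *m T^T = Sigma' ->
  couplings (gaussian x Sigma) (gaussian x Sigma')
    (distribution G (affine2 x (mxsqrt Sigma) T)).
Proof.
move=> /mxsqrtP[Ssym SS] TT; split=> B mB.
  congr (G _); apply/seteqP; by split=> [z []|z ?].
transitivity (G (affine x T @^-1` B)).
  congr (G _); apply/seteqP; by split=> [z []|z ?].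
by apply: std_gaussian_affine_law => //; rewrite TT Ssym SS.
Qed.

Lemma integral_marginal1 (mu nu : probability 'cV[R]_n R) pi (h : 'cV[R]_n -> \bar R) :
  couplings mu nu pi -> measurable_fun setT h -> (forall z, 0 <= h z)%E ->
  (\int[pi]_z h z.1 = \int[mu]_z h z)%E.
Proof.
move=> [pi1 _] mh h0.
rewrite -(@ge0_integral_pushforward _ _ _ _ R _ measurable_fst pi setT h)//.
apply: eq_measure_integral => B mB _.
transitivity (pi (B `*` setT)); last exact: pi1.
by congr (pi _); apply/seteqP; split=> [z|z []].
Qed.

End couplings.

Section projection_distance.
Context {R : realType} (n : nat).
Variables (A : 'M[R]_n) (x : 'cV[R]_n) (u : nat -> 'cV[R]_n) (f : nat -> R).
Variables (a b c : nat).
Hypotheses (Apsd : possemidef A) (f0 : forall i, 0 <= f i).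
Hypotheses (abc : (a <= b <= c)%N) (Au : A_orthonormal A u a c).
Notation G := (std_gaussian R n).
Let Gam := rank1sum u f a c.
Let Gam' := rank1sum u f a b.

Let measurable_diff : measurable_fun setT
  (fun z : 'cV[R]_n * 'cV[R]_n => z.1 - z.2).
Proof.
apply/measurable_fun_coordP => i; under eq_fun do rewrite !mxE.
apply: measurable_funD; first exact: (measurableT_comp (measurable_coord i) measurable_fst).
apply: measurableT_comp => //.
exact: (measurableT_comp (measurable_coord i) measurable_snd).
Qed.

Let measurable_sub : measurable_fun setT (fun z : 'cV[R]_n => z - x).
Proof.
apply/measurable_fun_coordP => i; under eq_fun do rewrite !mxE.
by apply: measurable_funD => //; exact: measurable_coord.
Qed.

(** The optimal plan sends M to its A-orthogonal projection x + P (M - x) on the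
    affine subspace that carries the second law. Its displacement (1 - P) (M - x)
    keeps exactly the terms of the covariance with b <= i < c, each of which
    contributes f i because the u i have unit A-norm. *)
Lemma projection_coupling_cost :
  exists2 pi, couplings (gaussian x Gam) (gaussian x Gam') pi &
  (\int[pi]_z (normA A (z.1 - z.2) ^+ 2)%:E = (\sum_(b <= i < c) f i)%:E)%E.
Proof.
have [Ssym SS] := mxsqrtP (rank1sum_psd u a c f0).
set S := mxsqrt _ in Ssym SS; rewrite -/Gam in SS.
pose P := rank1sum u (fun=> 1) a b *m A.
have [ab bc] := andP abc.
have SST : S *m S^T = Gam by rewrite Ssym.
have PP : (P *m S) *m (P *m S)^T = Gam'.
  rewrite trmx_mul !mulmxA -(mulmxA P) SST rank1sum_conj /rank1sum.
  rewrite (big_cat_nat ab bc)/= [X in _ + X]big_nat_cond [X in _ + X]big1 ?addr0.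
    apply: eq_big_nat => i /andP[ai ib].
    by rewrite (A_proj_basis abc Au) ?ib// ai (leq_trans ib).
  move=> i /andP[/andP[bi ic] _]; rewrite (A_proj_basis abc Au) ?(leq_trans ab)//.
  by rewrite ltnNge bi mul0mx scaler0.
exists (distribution G (affine2 x S (P *m S))).
  exact: affine2_coupling (rank1sum_psd u a b f0) PP.
rewrite ge0_integral_distribution//; last 2 first.
- exact: measurable_normA_sqr.
- by move=> z; rewrite lee_fin sqr_ge0.
pose L := (1%:M - P) *m S.
transitivity (\int[G]_z (normA A (L *m z) ^+ 2)%:E)%E.
  apply: eq_integral => z _ /=; congr ((normA A _ ^+ 2)%:E).
  by rewrite /affine opprD addrACA subrr add0r /L mulmxBl mul1mx mulmxBl.
rewrite std_gaussian_normA_moment//; congr EFin.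
have -> : L *m L^T = rank1sum (fun i => (1%:M - P) *m u i) f a c.
  by rewrite -rank1sum_conj -/Gam -SST /L trmx_mul !mulmxA.
rewrite mxtrace_rank1sum (big_cat_nat ab bc)/= big_nat_cond big1 ?add0r.
  apply: eq_big_nat => i /andP[bi ic].
  have iac : (a <= i < c)%N by rewrite (leq_trans ab).
  rewrite mulmxBl mul1mx (A_proj_basis abc Au)// ltnNge bi subr0.
  by rewrite Au// eqxx mulr1.
move=> i /andP[/andP[ai ib] _].
rewrite mulmxBl mul1mx (A_proj_basis abc Au) ?ib ?ai ?(leq_trans ib)//.
by rewrite subrr mulmx0 /dot mulmx0 mxE mulr0.
Qed.

(** Under the second law, the A-inner product of u i with N - x, for b <= i < c,
    has variance 0 and vanishes almost surely. By Bessel, the cost is therefore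
    at least the sum of the squared A-inner products of these u i with M - x; the
    integral of this sum depends on the first marginal only and is the sum of the
    variances f i. *)
Lemma coupling_cost_ge pi : couplings (gaussian x Gam) (gaussian x Gam') pi ->
  ((\sum_(b <= i < c) f i)%:E <= \int[pi]_z (normA A (z.1 - z.2) ^+ 2)%:E)%E.
Proof.
move=> cpi; have [ab bc] := andP abc.
have [Asym _] := Apsd.
have Aub : A_orthonormal A u b c.
  move=> i j /andP[bi ic] /andP[bj jc]; apply: Au; apply/andP; split => //;
  exact: leq_trans ab _.
pose h i (z : 'cV[R]_n * 'cV[R]_n) : \bar R := (dot (A *m u i) (z.1 - z.2) ^+ 2)%:E.
have mh i : measurable_fun setT (h i) by exact: measurable_dot_sqr.
apply: (@le_trans _ _ (\int[pi]_z \sum_(b <= i < c) h i z)%E); last first.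
  apply: ge0_le_integral => //.
  - by move=> z _; rewrite sume_ge0// => i _; rewrite lee_fin sqr_ge0.
  - exact: emeasurable_sum.
  - exact: measurable_normA_sqr.
  - by move=> z _; rewrite sumEFin lee_fin normA_sqrE//; exact: A_bessel.
rewrite ge0_integral_sum//; last by move=> i z _; rewrite lee_fin sqr_ge0.
rewrite -sumEFin le_eqVlt; apply/orP; left; apply/eqP.
apply: eq_big_nat => i /andP[bi ic].
have iac : (a <= i < c)%N by rewrite (leq_trans ab).
have ADot j w : dot (A *m u j) w = dot (u j) (A *m w).
  by rewrite /dot trmx_mul Asym mulmxA.
have quad a' c' : dot (A *m u i) (rank1sum u f a' c' *m (A *m u i)) =
    \sum_(a' <= j < c') f j * dot (u j) (A *m u i) ^+ 2.
  by rewrite rank1sum_quad.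
pose k (z : 'cV[R]_n) : \bar R := (dot (A *m u i) (z - x) ^+ 2)%:E.
have mk : measurable_fun setT k by exact: measurable_dot_sqr.
(* N may be replaced by the mean x, off the null set where the inner product of
   N - x with A u i is nonzero. *)
transitivity (\int[pi]_z k z.1)%E; last first.
  apply: ge0_ae_eq_integral => //.
  - exact: measurableT_comp.
  - by move=> z _; rewrite lee_fin sqr_ge0.
  - by move=> z _; rewrite lee_fin sqr_ge0.
  pose F := [set y : 'cV[R]_n | dot (A *m u i) (y - x) != 0].
  have mF : measurable F.
    have : measurable_fun setT (fun y : 'cV[R]_n => dot (A *m u i) (y - x)).
      exact: measurable_dot.
    move=> /(_ measurableT _ (measurableC (measurable_set1 (0 : R)))).
    rewrite setTI; congr (measurable _).
    by apply/seteqP; split=> y /= /eqP.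
  exists (setT `*` F); split.
  + exact: measurableX.
  + have [_ pi2] := cpi.
    transitivity (gaussian x Gam' F); first exact: pi2.
    have [Ssym SS] := mxsqrtP (rank1sum_psd u a b f0); rewrite -/Gam' in Ssym SS.
    (* The squared length of this vector is the variance of the inner product. *)
    have S0 : mxsqrt Gam' *m (A *m u i) = 0.
      apply/eqP; rewrite -dot_eq0 /dot trmx_mul Ssym -mulmxA.
      rewrite (mulmxA (mxsqrt Gam') (mxsqrt Gam')) SS.
      rewrite -/(dot _ _) quad big_nat_cond big1// => j /andP[/andP[aj jb] _].
      rewrite Au ?aj ?(leq_trans jb)//; case: eqP => [ji|_].
        by move: jb; rewrite ji ltnNge bi.
      by rewrite expr0n mulr0.
    transitivity (G (affine x (mxsqrt Gam') @^-1` F)); first by [].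
    rewrite (_ : _ @^-1` F = set0) ?measure0//.
    apply/seteqP; split=> // z /= /eqP; apply.
    rewrite /affine addrC addKr /dot mulmxA -{1}Ssym -trmx_mul S0.
    by rewrite trmx0 mul0mx mxE.
  + move=> z /= /not_implyP[_ kh]; split => //=; apply/eqP => zF; apply: kh.
    rewrite /k /h; congr (_ ^+ 2)%:E.
    have -> : z.1 - z.2 = (z.1 - x) - (z.2 - x) by rewrite opprB addrA subrK.
    by rewrite [RHS]dotDr dotNr zF subr0.
rewrite (integral_marginal1 cpi)//; last by move=> z; rewrite lee_fin sqr_ge0.
rewrite ge0_integral_distribution//; last by move=> z; rewrite lee_fin sqr_ge0.
have [Ssym SS] := mxsqrtP (rank1sum_psd u a c f0); rewrite -/Gam in Ssym SS.
transitivity (\int[G]_z (dot (mxsqrt Gam *m (A *m u i)) z ^+ 2)%:E)%E.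
  rewrite std_gaussian_second_moment; congr EFin.
  rewrite /dot trmx_mul Ssym -mulmxA (mulmxA (mxsqrt Gam) (mxsqrt Gam)) SS -/(dot _ _) quad.
  rewrite -[LHS](@big_nat_delta _ a c R^o f i iac).
  apply: eq_big_nat => j jac; rewrite Au// [LHS]mulrC.
  by case: eqP; rewrite ?expr1n ?expr0n.
apply: eq_integral => z _ /=; congr (_ ^+ 2)%:E.
by rewrite /affine addrC addKr /dot trmx_mul Ssym mulmxA.
Qed.

Lemma wassersteinA_projection :
  wassersteinA A (gaussian x Gam) (gaussian x Gam') =
  (Num.sqrt (\sum_(b <= i < c) f i))%:E.
Proof.
rewrite /wassersteinA (_ : ereal_inf _ = (\sum_(b <= i < c) f i)%:E)//.
apply/eqP; rewrite eq_le; apply/andP; split.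
  have [pi cpi <-] := projection_coupling_cost.
  by apply: ge_ereal_inf; eexists; first by exists pi.
by apply/ereal_infP => _ [pi cpi <-]; exact: coupling_cost_ge.
Qed.

End projection_distance.

(** * Krylov posteriors *)

Section krylov.
Context {R : realType} (n : nat).

(** In this form, the rank-d approximation is a truncation of the sum that gives
    the posterior covariance. *)
Lemma krylov_covE (v : nat -> 'cV[R]_n) r i j :
  krylov_cov v r i j = rank1sum v (phi v r) i j.+1.
Proof.
rewrite /krylov_cov /rank1sum -[X in \sum_(X <= _ < _) _]add0n big_addn big_mkord.
apply/matrixP => k l; rewrite summxE mxE; apply: eq_bigr => q _.
rewrite mul_mx_diag !mxE big_ord1 !mxE addnC; ring.
Qed.

Lemma krylov_basis_orthonormal A r g (v : nat -> 'cV[R]_n) :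
  is_krylov_basis A r g v -> A_orthonormal A v 1 g.+1.
Proof.
move=> [VAV _] i j /andP[i1 ig] /andP[j1 jg].
case: i i1 ig => // i _ ig; case: j j1 jg => // j _ jg.
have bnd k : (k.+1 < g.+1)%N -> (k < g.+1 - 1)%N by rewrite subn1.
have /matrixP/(_ (Ordinal (bnd i ig)) (Ordinal (bnd j jg))) := VAV.
rewrite [in RHS]mxE -val_eqE /= eqSS => <-.
have vE k (kg : (k.+1 < g.+1)%N) : v k.+1 = col (Ordinal (bnd k kg)) (vcols v 1 g).
  by apply/colP => q; rewrite !mxE.
rewrite (vE i ig) (vE j jg) /dot mulmxA mxE [RHS]mxE.
apply: eq_bigr => q _; rewrite !mxE; congr (_ * _).
by apply: eq_bigr => s _; rewrite !mxE.
Qed.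

End krylov.

Theorem theorem13 (R : realType) (n : nat) (A : 'M[R]_n)
    (b xstar x0 r0 : 'cV[R]_n) (g d m : nat) (v : nat -> 'cV[R]_n)
    (A_posdef : posdef A) (Ax_b : A *m xstar = b)
    (r0E : r0 = b - A *m x0) (r0_neq0 : r0 != 0)
    (g_grade : is_grade A r0 g) (v_basis : is_krylov_basis A r0 g v)
    (d_ge1 : (1 <= d)%N) (m_range : (1 <= m < g - d)%N) :
  wassersteinA A (krylov_posterior v x0 r0 g m) (approx_posterior v x0 r0 d m) =
  (Num.sqrt (\sum_((m + d).+1 <= i < g.+1) phi v r0 i))%:E.
Proof.
have A_psd : possemidef A.
  have [Asym Apos] := A_posdef; split=> // x.
  have [->|x0'] := eqVneq x 0; first by rewrite mulmx0 mxE.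
  exact/ltW/Apos.
have mdg : (m + d < g)%N by rewrite addnC -ltn_subRL; case/andP: m_range.
rewrite /krylov_posterior /approx_posterior !krylov_covE.
apply: wassersteinA_projection => //.
- by move=> i; exact: sqr_ge0.
- by rewrite !ltnS leq_addr ltnW.
- move=> i j /andP[mi ig] /andP[mj jg].
  by apply: (krylov_basis_orthonormal v_basis); rewrite ?ig ?jg ?(leq_trans _ mi) ?(leq_trans _ mj).
Qed.
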